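(* Let $\Sigma=\{0,1\}^{\mathbb{Z}}$ with the left shift $\sigma$, let $F(x,p)=(\sigma(x),f_x(p))$ be a random composition of homeomorphisms of $\mathbb{T}^2$ over $\sigma$, and let $\widetilde F(x,\widetilde p)=(\sigma(x),\widetilde f_x(\widetilde p))$ be a continuous lift of $F$ to $\Sigma\times\mathbb{R}^2$. Then the Misiurewicz-Ziemian rotation set $\rho_{mz}(\widetilde F)$ is a nonempty, compact and connected subset of $\mathbb{R}^2$.
   Context: $\mathbb{T}^2=\mathbb{R}^2/\mathbb{Z}^2$ and $\pi:\mathbb{R}^2\to\mathbb{T}^2$ is the covering map. $\Sigma=\{0,1\}^{\mathbb{Z}}$ carries the product topology and $\sigma((x_n)_{n\in\mathbb{Z}})=(x_{n+1})_{n\in\mathbb{Z}}$. A random composition of homeomorphisms of $\mathbb{T}^2$ over $\sigma$ is a continuous map $F:\Sigma\times\mathbb{T}^2\to\Sigma\times\mathbb{T}^2$ of the form $F(x,p)=(\sigma(x),f_x(p))$, where each $f_x$ is a homeomorphism of $\mathbb{T}^2$ homotopic (equivalently, isotopic) to the identity. For each $x$ a lift $\widetilde f_x:\mathbb{R}^2\to\mathbb{R}^2$ of $f_x$ (that is, $\pi\circ\widetilde f_x=f_x\circ\pi$) is fixed so that $x\mapsto\widetilde f_x$ is continuous; this defines $\widetilde F(x,\widetilde p)=(\sigma(x),\widetilde f_x(\widetilde p))$. Each $\widetilde f_x$ commutes with integer translations. Write $\widetilde f^n_x=\widetilde f_{\sigma^{n-1}(x)}\circ\cdots\circ\widetilde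 f_{\sigma(x)}\circ\widetilde f_x$. For $(x,p)\in\Sigma\times\mathbb{T}^2$ and $n\ge 1$, let $\rho_n(x,p)=\frac{\widetilde f^n_x(\widetilde p)-\widetilde p}{n}\in\mathbb{R}^2$ for any $\widetilde p\in\pi^{-1}(p)$ (independent of the choice of $\widetilde p$). Let $D_n=\{\rho_n(x,p):(x,p)\in\Sigma\times\mathbb{T}^2\}$ and $$\rho_{mz}(\widetilde F)=\bigcap_{N\in\mathbb{N}}\overline{\bigcup_{n\ge N}D_n}.$$ *)

(* Defs.v *)
From HB Require Import structures.
From mathcomp Require Import all_boot all_order all_algebra.
From mathcomp Require Import generic_quotient.
From mathcomp Require Import all_classical all_reals all_analysis.

Set Implicit Arguments.
Unset Strict Implicit.
Unset Printing Implicit Defensive.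

Import Order.TTheory GRing.Theory Num.Theory.
Import numFieldNormedType.Exports.

Local Open Scope classical_set_scope.
Local Open Scope ring_scope.
Local Open Scope quotient_scope.

Definition Sigma : Type := {ptws int -> bool}.
HB.instance Definition _ := Pointed.on Sigma.
HB.instance Definition _ := Topological.on Sigma.

Definition left_shift (x : Sigma) : Sigma := fun n => x (n + 1).

(* The torus R^2 / Z^2: two vectors are identified when their difference has
   integer coordinates, and the quotient carries the quotient topology. *)
Section Torus.
Variable R : realType.

Definition lattice_rel (p q : 'rV[R]_2) : bool := p - q \is a mxOver Num.int.

Lemma lattice_rel_equiv : equiv_class_of lattice_rel.
Proof.
split => [p|p q|q p r]; rewrite /lattice_rel.
- by apply/mxOverP => i j; rewrite subrr mxE rpred0.
- by apply/mxOverP/mxOverP => h i j; rewrite -opprB mxE rpredN.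
- move=> /mxOverP pq /mxOverP qr; apply/mxOverP => i j.
  by rewrite -(subrKA q) mxE rpredD.
Qed.

Canonical lattice_equiv := EquivRelPack lattice_rel_equiv.

Definition torus : Type := quotient_topology {eq_quot lattice_rel}.
HB.instance Definition _ := Topological.on torus.
HB.instance Definition _ := Quotient.on torus.

Definition torus_proj (p : 'rV[R]_2) : torus := \pi_torus p.

Lemma torus_projP (p q : 'rV[R]_2) :
  torus_proj p = torus_proj q <-> forall j, p ord0 j - q ord0 j \is a Num.int.
Proof.
rewrite /torus_proj; split.
  move=> /eqmodP /mxOverP h j; by move: (h ord0 j); rewrite !mxE.
by move=> h; apply/eqmodP/mxOverP => i j; rewrite !mxE (ord1 i).
Qed.
End Torus.

Definition homeomorphism (T U : topologicalType) (f : T -> U) : Prop :=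
  continuous f /\
  exists g : U -> T, [/\ continuous g, cancel f g & cancel g f].

Definition homotopic (R : realType) (T U : topologicalType) (f g : T -> U) :
  Prop :=
  exists H : R * T -> U,
    [/\ {within `[0, 1] `*` [set: T], continuous H},
        forall t, H (0, t) = f t & forall t, H (1, t) = g t].

(* The skew product (x, p) |-> (sigma x, f_x p). *)
Definition skew (X : Type) (f : Sigma -> X -> X) (xp : Sigma * X) : Sigma * X :=
  (left_shift xp.1, f xp.1 xp.2).

Definition random_composition (R : realType) (f : Sigma -> torus R -> torus R)
  : Prop :=
  continuous (skew f) /\
  forall x, homeomorphism (f x) /\ homotopic R (f x) idfun.

(* Continuity is that of the map (x, p) |-> (sigma x, tf_x p) on Sigma * R^2;
   lift_continuousP below relates it to the continuity of x |-> tf_x. *)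
Definition continuous_lift (R : realType) (f : Sigma -> torus R -> torus R)
    (tf : Sigma -> 'rV[R]_2 -> 'rV[R]_2) : Prop :=
  continuous (skew tf) /\
  forall x p, torus_proj (tf x p) = f x (torus_proj p).

Fixpoint fiber_iter (X : Type) (f : Sigma -> X -> X) (n : nat) (x : Sigma)
    (p : X) : X :=
  if n is m.+1 then f (iter m left_shift x) (fiber_iter f m x p) else p.

(* The set D_n of the values rho_n(x, p), taken over all the preimages q of p
   (the value does not depend on q under the hypotheses of interest). *)
Definition rho_set (R : realType) (tf : Sigma -> 'rV[R]_2 -> 'rV[R]_2)
    (n : nat) : set 'rV[R]_2 :=
  [set v | exists x : Sigma, exists p : torus R,
     exists2 q : 'rV[R]_2, torus_proj q = p &
       v = n%:R^-1 *: (fiber_iter tf n x q - q)].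

(* N ranges over the positive integers because D_n is only meant for n >= 1. *)
Definition rho_mz (R : realType) (tf : Sigma -> 'rV[R]_2 -> 'rV[R]_2) :
    set 'rV[R]_2 :=
  \bigcap_(N in [set N : nat | (0 < N)%N])
    closure (\bigcup_(n in [set n : nat | (N <= n)%N]) rho_set tf n).

Lemma iter_skew (X : Type) (f : Sigma -> X -> X) n x p :
  iter n (skew f) (x, p) = (iter n left_shift x, fiber_iter f n x p).
Proof. by elim: n => //= n ->. Qed.

Lemma left_shift_continuous : continuous left_shift.
Proof.
move=> x; apply/(@cvg_sup _ _ _ (left_shift @ x) (left_shift x)) => i U.
have /= -> := @nbhsE (initial_topology (fun f : int -> bool => f i)) _.
move=> [_ [[C oC <-] Cx] CU].
apply: (@filterS _ (nbhs x) _ ((@proj int (fun=> bool) (i + 1)) @^-1` C)).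
  by move=> y Cy; exact: CU.
by apply: (@proj_continuous int (fun=> bool)); exact: open_nbhs_nbhs.
Qed.

Lemma skew_continuousP (X : topologicalType) (f : Sigma -> X -> X) :
  locally_compact [set: X] -> hausdorff_space X ->
  continuous (skew f) <->
  (forall x, continuous (f x)) /\
  continuous (f : Sigma -> {compact-open, X -> X}).
Proof.
move=> lcX hX; split=> [cf|[cfx cf]].
  have cuf : continuous (uncurry f).
    have -> : uncurry f = snd \o skew f by apply/funext => -[].
    by move=> xp; apply: continuous_comp; [exact: cf | exact: cvg_snd].
  by have [] := continuous_curry cuf.
have cuf := continuous_uncurry lcX hX cf cfx.
have cs : continuous (left_shift \o @fst Sigma X).
  move=> xp; apply: continuous_comp; first exact: cvg_fst.
  exact: left_shift_continuous.
have -> : skew f = (fun xp => ((left_shift \o fst) xp, uncurry f xp)).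
  by apply/funext => -[].
by move=> xp; apply: (cvg_pair (cs xp) (cuf xp)).
Qed.

Lemma rV_locally_compact (R : realType) n : locally_compact [set: 'rV[R]_n.+1].
Proof.
move=> x _; rewrite withinET; exists (closed_ball x 1).
  by apply: filterS (nbhsx_ballx x _ ltr01); exact: subset_closed_ball.
split; last exact: closed_ball_closed.
apply: bounded_closed_compact; last exact: closed_ball_closed.
exists (`|x| + 1); split; first exact: num_real.
move=> M xM y; rewrite closed_ballE// /closed_ball_/= => xy.
rewrite (le_trans _ (ltW xM))// -(subrK x y) (le_trans (ler_normD _ _))//.
by rewrite addrC lerD2l distrC.
Qed.

Lemma lift_continuousP (R : realType) (tf : Sigma -> 'rV[R]_2 -> 'rV[R]_2) :
  continuous (skew tf) <->
  (forall x, continuous (tf x)) /\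
  continuous (tf : Sigma -> {compact-open, 'rV[R]_2 -> 'rV[R]_2}).
Proof.
apply: skew_continuousP; first exact: rV_locally_compact.
exact: norm_hausdorff.
Qed.

(* Main.v *)
Require Import Defs.
From mathcomp Require Import all_boot all_order all_algebra.
From mathcomp Require Import all_classical all_reals all_analysis.
From mathcomp Require Import zify ring lra.
Import numFieldNormedType.Exports.
Local Open Scope classical_set_scope.
Import Order.TTheory GRing.Theory Num.Theory.
Local Open Scope ring_scope.
Set Implicit Arguments.
Unset Strict Implicit.

(** Write v_n(x, q) = (tf^n_x q - q) / n, so that D_n is the range of v_n.

    Boundedness.  Because f_x is homotopic to the identity, tf_x commutes with
    integer translations; the displacement tf_x q - q is then periodic in q,
    hence bounded by a constant C by compactness of Sigma times a ball that
    contains a fundamental domain.  All the D_n with n >= 1 lie in the closed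
    ball of radius C, so their upper limit is compact; it contains the cluster
    points of any choice of one point in each D_n, hence is nonempty
    ([limsup_set_meets]).

    Translation equivariance ([lift_equivariant]).  The identity map of the
    torus has an equivariant lift, namely the identity of the plane.  A
    map uniformly close to one with an equivariant lift has an equivariant lift
    as well: choose the preimage nearest to the given lift.  Cutting a homotopy
    into short steps carries the property from the identity to f_x.  Two
    continuous lifts of f_x differ by a constant integer vector, so every
    continuous lift is equivariant.

    Connectedness.  Sigma is totally disconnected, so D_n itself need not be
    connected.  It is however coarsely connected
    ([rho_set_coarsely_connected]): it cannot be split by two open sets at
    distance more than 2C/n.  Each fibre {v_n(x, q) : q} is connected, hence on
    one side; the fibres over x and over its shift are 2C/n-close, so the set
    of x whose fibre is on a given side is shift invariant; this set is clopen,
    and the shift is topologically transitive, so it is empty or everything.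
    Consecutive sets D_n and D_{n+1} are also 2C/n-close.  If the upper limit
    were a union of two disjoint nonempty closed sets, the D_n would eventually
    lie in disjoint fattenings of the two pieces, at a positive distance, hence
    all on the same side, and the other piece would not be approached
    ([limsup_set_connected]). *)

(** * Integer vectors and the torus *)

Section Lattice.
Variable R : realType.
Implicit Types (v w p q : 'rV[R]_2).

Lemma integralB v w : v \is a mxOver Num.int -> w \is a mxOver Num.int ->
  v - w \is a mxOver Num.int.
Proof.
move=> /mxOverP iv /mxOverP iw; apply/mxOverP => i j; rewrite !mxE.
exact: rpredB.
Qed.

Lemma integralN v : v \is a mxOver Num.int -> - v \is a mxOver Num.int.
Proof.
by rewrite -sub0r => iv; apply: integralB => //; apply/mxOverP => i j; rewrite mxE rpred0.
Qed.

Lemma torus_proj_eqP p q :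
  torus_proj p = torus_proj q <-> p - q \is a mxOver Num.int.
Proof.
rewrite torus_projP; split => [h|/mxOverP h j].
  by apply/mxOverP => i j; rewrite (ord1 i) !mxE.
by have := h ord0 j; rewrite !mxE.
Qed.

Lemma torus_projD p v : v \is a mxOver Num.int ->
  torus_proj (p + v) = torus_proj p.
Proof. by move=> iv; apply/torus_proj_eqP; rewrite addrAC subrr add0r. Qed.

Lemma torus_proj_surj (a : torus R) : exists p, torus_proj p = a.
Proof. by exists (repr a); rewrite /torus_proj generic_quotient.reprK. Qed.

Lemma coord_norm_le v j : `|v ord0 j| <= `|v|.
Proof.
rewrite [leRHS]/Num.norm /= mx_normrE.
by apply/bigmax_geP; right => /=; exists (ord0, j).
Qed.

Lemma integral_norm_lt1 v : v \is a mxOver Num.int -> `|v| < 1 -> v = 0.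
Proof.
move=> /mxOverP iv v1; apply/rowP => j; rewrite mxE.
apply/eqP; apply: contraTT v1 => vj0; rewrite -leNgt.
apply: le_trans (coord_norm_le v j).
exact: norm_intr_ge1.
Qed.

Lemma integral_approx q :
  exists2 v, v \is a mxOver Num.int & `|q - v| <= 1.
Proof.
exists (\row_j (Num.floor (q ord0 j))%:~R).
  by apply/mxOverP => i j; rewrite mxE; exact: intr_int.
rewrite [leLHS]/Num.norm /= mx_normrE; apply/bigmax_leP; split=> // -[i j] _ /=.
rewrite !mxE (ord1 i) ger0_norm ?subr_ge0 ?floor_le//.
by rewrite lerBlDl ltW// -intrD1 floorD1_gt.
Qed.

Lemma torus_proj_continuous : continuous (@torus_proj R).
Proof. exact: pi_continuous. Qed.

(** The projection is open: the preimage of the image of a ball is the union of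
    the integer translates of that ball. *)
Lemma nbhs_torus_proj p (e : R) : 0 < e ->
  nbhs (torus_proj p) [set a | exists2 q, torus_proj q = a & `|p - q| < e].
Proof.
move=> e0; apply: open_nbhs_nbhs; split; last by exists p; rewrite ?subrr ?normr0.
rewrite /open/= /quotient_open openE => q [w wq pw].
have iqw : q - w \is a mxOver Num.int by apply/torus_proj_eqP.
apply/nbhs_ballP; exists (e - `|p - w|) => /=; first by rewrite subr_gt0.
move=> r; rewrite -ball_normE/= => qr.
exists (r - (q - w)).
  by apply: torus_projD; exact: integralN.
have -> : p - (r - (q - w)) = (p - w) + (q - r).
  by rewrite opprB !addrA (addrAC p q).
by rewrite (le_lt_trans (ler_normD _ _))// -ltrBrDl.
Qed.

Lemma closed_ball_compact (c : R) : 0 < c -> compact (closed_ball (0 : 'rV[R]_2) c).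
Proof.
move=> c0; apply: bounded_closed_compact; last exact: closed_ball_closed.
exists c; split; first exact: gtr0_real.
move=> M cM y; rewrite closed_ballE//= /closed_ball_/=.
by rewrite sub0r normrN => /le_trans -> //; exact: ltW.
Qed.

Lemma torus_compact : compact [set: torus R].
Proof.
have -> : [set: torus R] = @torus_proj R @` closed_ball 0 1.
  apply/seteqP; split => // a _; have [p <-] := torus_proj_surj a.
  have [v iv pv] := integral_approx p.
  exists (p - v); last by apply: torus_projD; exact: integralN.
  by rewrite closed_ballE//= /closed_ball_/= sub0r normrN.
apply: continuous_compact.
  exact/continuous_subspaceT/torus_proj_continuous.
exact: closed_ball_compact.
Qed.
End Lattice.

Lemma normedMod_connected (R : realType) (V : normedModType R) :
  connected [set: V].
Proof.
have -> : [set: V] = \bigcup_(v in [set: V]) ((fun t : R => t *: v) @` `[0, 1]).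
  apply/seteqP; split => // v _; exists v => //; exists 1; rewrite ?scale1r//=.
  by rewrite in_itv/= ler01 lexx.
apply: bigcup_connected.
  exists 0 => v _; exists 0; rewrite ?scale0r//=.
  by rewrite in_itv/= ler01 lexx.
move=> v _; apply: connected_continuous_connected; first exact: segment_connected.
apply: continuous_subspaceT => t.
by apply: cvgZr_tmp; exact: cvg_id.
Qed.

(** A level set is closed, and open because distinct integer vectors are at
    distance at least 1; the domain is connected. *)
Lemma integral_valued_constant (R : realType) (V : normedModType R)
    (u : V -> 'rV[R]_2) :
  continuous u -> (forall p q, u p - u q \is a mxOver Num.int) ->
  forall p q, u p = u q.
Proof.
move=> cu iu p q.
suff : [set r | u r = u q] = setT by move=> /seteqP[_ /(_ p)]; exact.
apply: (@normedMod_connected R V); first by exists q.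
- exists (u @^-1` ball (u q) 1).
    by move/continuousP: cu; apply; exact: ball_open.
  rewrite setTI; apply/seteqP; split => r /=; first by move=> ->; exact: ballxx.
  rewrite -ball_normE/= => /(integral_norm_lt1 (iu _ _))/eqP.
  by rewrite subr_eq0 => /eqP ->.
- exists (u @^-1` [set u q]); last by rewrite setTI.
  apply: closed_comp; first by move=> r _; exact: cu.
  apply: (@accessible_closed_set1 'rV[R]_2).
  apply: hausdorff_accessible; exact: norm_hausdorff.
Qed.

(** * Lifts of torus maps homotopic to the identity *)

Section Lifts.
Variable R : realType.
Local Notation plane := ('rV[R]_2).

Definition translation_equivariant (g : plane -> plane) : Prop :=
  forall q v, v \is a mxOver Num.int -> g (q + v) = g q + v.

Definition equivariant_lift (h : torus R -> torus R) (g : plane -> plane) :=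
  [/\ continuous g, forall q, torus_proj (g q) = h (torus_proj q)
    & translation_equivariant g].

Definition torus_close (e : R) (a b : torus R) : Prop :=
  exists p q, [/\ torus_proj p = a, torus_proj q = b & `|p - q| < e].

Lemma close_lift (a b : torus R) (e : R) p : torus_close e a b ->
  torus_proj p = a -> exists2 q, torus_proj q = b & `|p - q| < e.
Proof.
move=> [p' [q [<- <- pq]]] /torus_proj_eqP ip; exists (q + (p - p')).
  exact: torus_projD.
by rewrite opprD addrC opprB -addrA subrK addrC.
Qed.

(** The new lift sends q to the only preimage of h' [q] within 1/4 of g q.
    Uniqueness of that preimage yields both its continuity and its
    equivariance, since preimages of a point are at mutual distance at least 1
    when distinct. *)
Lemma equivariant_lift_perturb h h' g :
  continuous h' -> equivariant_lift h g ->
  (forall a, torus_close 4^-1 (h a) (h' a)) ->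
  exists g', equivariant_lift h' g'.
Proof.
move=> ch' [cg lg eg] hh'.
have small q w w' : torus_proj w = h' (torus_proj q) ->
    torus_proj w' = h' (torus_proj q) ->
    `|g q - w| < 4^-1 -> `|g q - w'| < 2^-1 -> w = w'.
  move=> pw pw' gw gw'; apply/eqP; rewrite -subr_eq0; apply/eqP.
  apply: integral_norm_lt1; first by apply/torus_proj_eqP; rewrite pw pw'.
  rewrite -(subrKA (g q)) (le_lt_trans (ler_normD _ _))// distrC.
  by move: gw gw'; lra.
have /choice[g' g'P] : forall q, exists w,
    torus_proj w = h' (torus_proj q) /\ `|g q - w| < 4^-1.
  by move=> q; have [w] := close_lift (hh' (torus_proj q)) (lg q); exists w.
exists g'; split.
- move=> q; apply/(@cvgrPdist_lt R plane _ (nbhs q)) => e e0.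
  (* With d <= 1/8, a preimage within d of g' q is within 1/8 + 1/4 + 1/8 of
     g q', the threshold under which it must be g' q'. *)
  pose d : R := Num.min e 8^-1.
  have d0 : 0 < d by rewrite lt_min e0/=; lra.
  have N1 : \forall q' \near q, `|g q - g q'| < 8^-1.
    by have /(@cvgrPdist_lt R plane _ (nbhs q)) := cg q; apply; lra.
  have N2 : \forall q' \near q, exists2 w,
      torus_proj w = h' (torus_proj q') & `|g' q - w| < d.
    have := nbhs_torus_proj (g' q) d0; rewrite (g'P q).1.
    apply: (continuous_comp (@torus_proj_continuous R q)).
    exact: ch'.
  near=> q'.
  have [w pw gw] : exists2 w,
      torus_proj w = h' (torus_proj q') & `|g' q - w| < d by near: q'.
  have gq' : `|g q - g q'| < 8^-1 by near: q'.
  have -> : g' q' = w.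
    apply: (@small q') => //; [exact: (g'P q').1|exact: (g'P q').2|].
    have -> : g q' - w = - (g q - g q') + (g q - g' q) + (g' q - w).
      by rewrite opprB !subrKA.
    rewrite (le_lt_trans (ler_normD _ _))//.
    have := ler_normD (- (g q - g q')) (g q - g' q); rewrite normrN.
    have := (g'P q).2; have : d <= 8^-1 by rewrite ge_min lexx orbT.
    move: gw gq'; lra.
  by rewrite (lt_le_trans gw)// ge_min lexx.
- by move=> q; have [] := g'P q.
- move=> q v iv; apply: (@small (q + v)).
  + exact: (g'P _).1.
  + by rewrite !torus_projD//; exact: (g'P _).1.
  + exact: (g'P _).2.
  + rewrite eg// opprD addrACA subrr addr0.
    by apply: lt_trans (g'P q).2 _; lra.
Unshelve. all: by end_near. Qed.

(** A homotopy on the compact set [0, 1] x T^2 is equicontinuous in time,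
    uniformly in the point of the torus. *)
Lemma homotopy_uniform (H : R * torus R -> torus R) (d : R) : 0 < d ->
  {within `[0, 1] `*` [set: torus R], continuous H} ->
  exists2 e : R, 0 < e & forall t t' a, t \in `[0, 1] -> t' \in `[0, 1] ->
    `|t - t'| < e -> torus_close d (H (t, a)) (H (t', a)).
Proof.
move=> d0 cH.
pose K : set (R * torus R) := `[0, 1] `*` [set: torus R].
have cK : compact K.
  by apply: compact_setX; [exact: segment_compact|exact: torus_compact].
pose P (e : R) (y : R * torus R) := forall t', t' \in `[0, 1] ->
  `|y.1 - t'| < e -> torus_close d (H y) (H (t', y.2)).
have : \forall e \near 0^'+, K `<=` P e.
  move/compact_near_coveringP/near_covering_withinP : cK; apply.
  move=> [t a] Kta.
  have [w wH] := torus_proj_surj (H (t, a)).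
  have d2 : 0 < d / 2 by lra.
  have := nbhs_torus_proj w d2; rewrite wH => N.
  move/subspace_continuousP : cH => /(_ _ Kta _ N).
  rewrite /= /within/= => -[[U V] /= [/nbhs_ballP[r /= r0 rU] Va] UV].
  exists ((ball t (r / 2) `*` V), [set e : R | 0 < e < r / 2]) => /=.
    split.
      by exists (ball t (r / 2), V) => //; split => //; apply: nbhsx_ballx; lra.
    near=> e => /=; apply/andP; split; near: e; first exact: nbhs_right_gt.
    by apply: nbhs_right_lt; lra.
  move=> [[t1 a1] e] /= [[t1r Va1] /andP[e0 er]] K1 t' t'01 /= t1t'.
  have rt1 : ball t r t1 by apply: le_ball t1r; lra.
  have rt' : ball t r t'.
    by rewrite (splitr r); apply: ball_triangle t1r _; rewrite -ball_normE/=; lra.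
  have [w1 w1H ww1] := UV (t1, a1) (conj (rU _ rt1) Va1) K1.
  have [w2 w2H ww2] := UV (t', a1) (conj (rU _ rt') Va1) (conj t'01 I).
  exists w1, w2; split => //.
  rewrite -(subrKA w) (le_lt_trans (ler_normD _ _))// distrC; lra.
move=> Ne; near (0 : R)^'+ => e.
exists e => [//|t t' a t01 t'01 tt'].
have : K `<=` P e by near: e.
by move=> /(_ (t, a) (conj t01 I) t'); apply.
Unshelve. all: by end_near. Qed.

Lemma homotopic_id_equivariant_lift (h : torus R -> torus R) :
  homotopic R h idfun -> exists g, equivariant_lift h g.
Proof.
move=> [H [cH H0 H1]].
have d0 : (0 : R) < 4^-1 by lra.
have [e e0 He] := homotopy_uniform d0 cH.
have cHt t : t \in `[0, 1] -> continuous (fun a => H (t, a)).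
  move=> t01 a; move/subspace_continuousP : cH => /(_ (t, a) (conj t01 I)) cHa.
  move=> N /cHa; rewrite /= /within/= => -[[U V] /= [Ut Va] UV].
  apply: filterS Va => b Vb.
  by apply: (UV (t, b)) => //; split => //; exact: nbhs_singleton.
have id_lift : equivariant_lift (fun a => H (1, a)) id.
  by split => [q|q|//]; [exact: cvg_id|rewrite H1].
have in1 : (1 : R) \in `[0, 1] by rewrite in_itv/= ler01 lexx.
(* Induction on the number of steps of length e / 2 needed to reach time 1,
   where the map is the identity. *)
suff main n t : t \in `[0, 1] -> 1 - t < n%:R * (e / 2) ->
    exists g, equivariant_lift (fun a => H (t, a)) g.
  have in0 : (0 : R) \in `[0, 1] by rewrite in_itv/= ler01 lexx.
  have e2 : 0 < e / 2 by lra.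
  have [|g gP] := main (Num.bound (e / 2)^-1) 0 in0.
    rewrite subr0 -ltr_pdivrMr// mul1r.
    by apply: archi_boundP; rewrite invr_ge0 ltW.
  by exists g; rewrite (_ : h = fun a => H (0, a))//; apply/funext => a; rewrite H0.
elim: n t => [t|n IH t].
  by rewrite mul0r in_itv/= => /andP[t0 t1]; lra.
move=> t01; rewrite -natr1 => tn; have := t01; rewrite in_itv/= => /andP[t0 t1].
have [t'1|t'1] := leP (t + e / 2) 1.
  have t'01 : t + e / 2 \in `[0, 1] by rewrite in_itv/= t'1 andbT; lra.
  have [|g gP] := IH (t + e / 2) t'01; first by lra.
  apply: (equivariant_lift_perturb (cHt _ t01) gP) => a.
  apply: He => //; rewrite addrAC subrr add0r ger0_norm; lra.
apply: (equivariant_lift_perturb (cHt _ t01) id_lift) => a.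
by apply: He => //; rewrite ger0_norm; lra.
Qed.

(** A continuous lift differs from an equivariant one by an integer valued
    continuous function, that is, by a constant. *)
Lemma lift_equivariant (h : torus R -> torus R) (g : plane -> plane) :
  homotopic R h idfun -> continuous g ->
  (forall q, torus_proj (g q) = h (torus_proj q)) ->
  translation_equivariant g.
Proof.
move=> /homotopic_id_equivariant_lift[g' [cg' lg' eg']] cg lg q v iv.
have cd : continuous (fun q => g q - g' q).
  by move=> r; exact: (cvgB (cg r) (cg' r)).
have id_ r s : (g r - g' r) - (g s - g' s) \is a mxOver Num.int.
  by apply: integralB; apply/torus_proj_eqP; rewrite lg lg'.
have /eqP := integral_valued_constant cd id_ (q + v) q.
by rewrite eg' // opprD addrA subr_eq addrAC => /eqP/addIr.
Qed.
End Lifts.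


(** * The shift *)

Lemma Sigma_compact : compact [set: Sigma].
Proof.
have := @tychonoff int (fun=> bool) (fun=> setT) (fun=> bool_compact).
by congr (compact _); apply/seteqP.
Qed.

Lemma Sigma_cvg (u : nat -> Sigma) (x : Sigma) :
  (forall i, \forall n \near \oo, u n i = x i) -> u @ \oo --> x.
Proof.
move=> ux; apply/(@cvg_sup _ _ _ (u @ \oo) x) => i U.
have /= -> := @nbhsE (initial_topology (fun f : int -> bool => f i)) _.
move=> [_ [[C oC <-] Cx] CU].
by apply: filterS (ux i) => n uni; apply: CU; rewrite /= uni.
Qed.

Lemma iter_left_shiftE n (x : Sigma) i : iter n left_shift x i = x (i + n%:Z).
Proof.
elim: n i => [i|n IH i]; first by rewrite addr0.
by rewrite iterS /left_shift IH -addrA intS.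
Qed.

(** Let z_n agree with x up to the index n and with y, moved right by 2n,
    afterwards.  Then z_n tends to x, while its 2n-th shift agrees with y on the
    indices above -n and tends to y. *)
Lemma left_shift_transitive (A B : set Sigma) :
  open A -> open B -> A !=set0 -> B !=set0 ->
  exists n x, A x /\ B (iter n left_shift x).
Proof.
move=> oA oB [x Ax] [y By].
pose z (n : nat) : Sigma :=
  fun i => if i <= n%:Z then x i else y (i - (n.*2)%:Z).
have zx : z @ \oo --> x.
  apply: Sigma_cvg => i; exists `|i|%N => // n /= ni.
  by rewrite /z ifT//; lia.
have zy : (fun n => iter n.*2 left_shift (z n)) @ \oo --> y.
  apply: Sigma_cvg => i; exists `|i|.+1%N => // n /= ni.
  by rewrite iter_left_shiftE /z addrK ifF//; lia.
have [n [An Bn]] : exists n, A (z n) /\ B (iter n.*2 left_shift (z n)).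
  near \oo => n; exists n; split; near: n.
    by apply: zx; apply: open_nbhs_nbhs.
  by apply: zy; apply: open_nbhs_nbhs.
by exists n.*2, (z n).
Unshelve. all: by end_near. Qed.

(** * Upper limits of coarsely connected sets *)

Section Limsup.
Variables (R : realType) (V : normedModType R).
Implicit Types (A B U W E : set V) (D : nat -> set V).

Definition limsup_set D : set V :=
  \bigcap_(N in [set N : nat | (0 < N)%N])
    closure (\bigcup_(n in [set n : nat | (N <= n)%N]) D n).

Lemma limsup_set_closed D : closed (limsup_set D).
Proof. by apply: closed_bigI => N _; exact: closed_closure. Qed.

Lemma limsup_set_sub D A : closed A ->
  (forall n, (0 < n)%N -> D n `<=` A) -> limsup_set D `<=` A.
Proof.
move=> cA DA v /(_ 1%N isT) vD; apply: cA; apply: closureS vD.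
by move=> w [n n0]; exact: DA.
Qed.

(** Both nonemptiness (E is everything) and the eventual inclusion of the D n in
    a neighbourhood of the limit (E is its complement) come from a cluster point
    of points of D n in E. *)
Lemma limsup_set_meets D A E : compact A ->
  (forall n, (0 < n)%N -> D n `<=` A) -> closed E ->
  (forall N : nat, exists2 n, (N <= n)%N & D n `&` E !=set0) ->
  limsup_set D `&` E !=set0.
Proof.
move=> cA DA cE DE.
have /choice[v vP] : forall N : nat, exists v : V,
    E v /\ exists2 n, (N.+1 <= n)%N & D n v.
  by move=> N; have [n Nn [v [Dv Ev]]] := DE N.+1; exists v; split => //; exists n.
have [|p [Ap pv]] := cA (v @ \oo) _.
  by exists 0%N => // n _ /=; have [_ [m nm /DA]] := vP n; apply; exact: leq_trans nm.
exists p; split; last first.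
  by apply: cE => B pB; apply: pv pB; exists 0%N => // n _ /=; have [] := vP n.
move=> N N0 B pB; apply: pv pB; exists N => // n /= Nn.
by have [_ [m nm Dm]] := vP n; exists m => //=; apply: leq_trans nm; rewrite leqW.
Qed.

Definition gap (e : R) U W := forall u w, U u -> W w -> e <= `|u - w|.

(** A connectedness at scale e, which unlike connectedness survives small
    perturbations. *)
Definition coarsely_connected (e : R) A := forall U W, open U -> open W ->
  gap e U W -> A `<=` U `|` W -> A `<=` U \/ A `<=` W.

Lemma gap_sym (e : R) U W : gap e U W -> gap e W U.
Proof. by move=> UW w u Ww Uu; rewrite distrC; exact: UW. Qed.

Lemma gap_disjoint (e : R) U W v : 0 < e -> gap e U W -> U v -> W v -> False.
Proof. by move=> e0 UW Uv /(UW _ _ Uv); rewrite subrr normr0; lra. Qed.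

Lemma connected_coarsely (e : R) A : 0 < e -> connected A ->
  coarsely_connected e A.
Proof.
move=> e0 cA U W oU oW UW AUW; apply: connected_subset cA => //.
split; rewrite -subset0 => v [].
  move=> /(_ W) + Wv => -[|u [Uu Wu]]; first exact: open_nbhs_nbhs.
  exact: (gap_disjoint e0 UW Uu Wu).
move=> Uv /(_ U) [|u [Wu Uu]]; first exact: open_nbhs_nbhs.
exact: (gap_disjoint e0 UW Uu Wu).
Qed.

Lemma coarsely_connected_fatten (e : R) A B : coarsely_connected e A ->
  A `<=` B -> (forall b, B b -> exists2 a, A a & `|a - b| < e) ->
  coarsely_connected e B.
Proof.
move=> cA AB BA U W oU oW UW BUW.
have [AU|AW] := cA U W oU oW UW (subset_trans AB BUW); [left|right] => b Bb;
    have [a Aa ab] := BA _ Bb; have [Ub|Wb] := BUW _ Bb => //.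
- by have := UW _ _ (AU _ Aa) Wb; rewrite leNgt ab.
- by have := gap_sym UW (AW _ Aa) Ub; rewrite leNgt ab.
Qed.

Lemma compact_closed_gap A B : compact A -> closed B -> A `&` B = set0 ->
  exists2 e : R, 0 < e & gap e A B.
Proof.
move=> cA cB AB0.
have : \forall e \near (0 : R)^'+, A `<=` (fun a => forall b, B b -> e <= `|a - b|).
  move/compact_near_coveringP/near_covering_withinP : cA; apply => a Aa.
  have : nbhs a (~` B).
    apply: open_nbhs_nbhs; split; first exact: closed_openC.
    by move=> Ba; have : (A `&` B) a by []; rewrite AB0.
  move=> /nbhs_ballP[r /= r0 rB].
  exists (ball a (r / 2), [set e : R | e < r / 2]) => /=.
    by split; [apply: nbhsx_ballx; lra|apply: nbhs_right_lt; lra].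
  move=> [a' e] /= [aa' er] _ b Bb; rewrite leNgt; apply/negP => a'b.
  apply: (rB b) => //; rewrite (splitr r); apply: ball_triangle aa' _.
  by rewrite -ball_normE /=; lra.
move=> Ne; near (0 : R)^'+ => e; exists e => // a b Aa.
have AP : A `<=` (fun a => forall b, B b -> e <= `|a - b|) by near: e.
exact: AP.
Unshelve. all: by end_near. Qed.

(** The unions of two consecutive sets are what the hypothesis is about: they
    make the side on which D n lies independent of n. *)
Lemma limsup_set_connected D A : compact A ->
  (forall n, (0 < n)%N -> D n `<=` A) -> (forall n, D n !=set0) ->
  (forall e : R, 0 < e -> \forall n \near \oo, coarsely_connected e (D n `|` D n.+1)) ->
  connected (limsup_set D).
Proof.
move=> cA DA D0 Dc B B0 [G oG BG] [C cC BC].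
pose L := limsup_set D; apply: contrapT => BnL.
have cL : compact L.
  apply: (subclosed_compact (@limsup_set_closed D) cA).
  exact: limsup_set_sub (compact_closed (@norm_hausdorff _ V) cA) DA.
have cB : compact B.
  apply: subclosed_compact cL _; last by rewrite BG; exact: subIsetl.
  by rewrite BC; apply: closedI => //; exact: limsup_set_closed.
pose B' := L `&` ~` G.
have cB' : closed B' by apply: closedI; [exact: limsup_set_closed|exact: open_closedC].
have B'0 : B' !=set0.
  apply: contrapT => B'0; apply: BnL; rewrite BG; apply/seteqP; split => v; first by case.
  by move=> Lv; split => //; apply: contrapT => Gv; apply: B'0; exists v.
have [|e e0 BB'] := compact_closed_gap cB cB'.
  by rewrite -subset0 BG => v [[_ Gv] [_]].
have e3 : 0 < e / 3 by lra.
pose fat (X : set V) := \bigcup_(v in X) ball v (e / 3).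
have ofat X : open (fat X) by apply: bigcup_open => v _; exact: ball_open.
have sfat X : X `<=` fat X by move=> v Xv; exists v => //; exact: ballxx.
have fatgap : gap (e / 3) (fat B) (fat B').
  move=> u w [b Bb bu] [b' Bb' bw]; have := BB' _ _ Bb Bb'.
  move: bu bw; rewrite -ball_normE/= => bu bw.
  have -> : b - b' = (b - u) + (u - w) + (w - b') by rewrite !subrKA.
  have := ler_normD ((b - u) + (u - w)) (w - b').
  have := ler_normD (b - u) (u - w); rewrite (distrC w b'); lra.
(* Otherwise the limit would have a point outside both fattenings. *)
have Dfat : \forall n \near \oo, D n `<=` fat B `|` fat B'.
  apply: contrapT => nD.
  have [||v [Lv]] := @limsup_set_meets D A (~` (fat B `|` fat B')) cA DA.
  - by apply: open_closedC; exact: openU.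
  - move=> N; apply: contrapT => nN; apply: nD; exists N => // n /= Nn v Dv.
    by apply: contrapT => nv; apply: nN; exists n => //; exists v.
  - apply; have [Gv|Gv] := pselect (G v).
      by left; apply: sfat; rewrite BG.
    by right; apply: sfat.
have [N _ HN] : \forall n \near \oo, D n `<=` fat B `|` fat B' /\
    coarsely_connected (e / 3) (D n `|` D n.+1).
  by near=> n; split; near: n => //; exact: Dc.
(* If one set is on the side of U, so are all the later ones, and then the
   limit cannot have a point in W. *)
have trapped U W : open U -> open W -> gap (e / 3) U W ->
    (forall n, (N <= n)%N -> D n `<=` U `|` W) -> D N `<=` U -> L `&` W !=set0 ->
    False.
  move=> oU oW UW DUW DNU [v [Lv Wv]].
  have DU n : (N <= n)%N -> D n `<=` U.
    move=> /subnK <-; elim: (n - N)%N => [//|k IH].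
    have kN : (N <= k + N)%N by exact: leq_addl.
    have [|DkU|DkW] := (HN _ kN).2 U W oU oW UW.
    - by rewrite subUset; split; apply: DUW => //; exact: leqW.
    - by move=> w Dw; apply: DkU; right.
    - have [w Dw] := D0 (k + N)%N.
      by exfalso; apply: (gap_disjoint e3 UW (IH _ Dw)); apply: DkW; left.
  have [//|w [[n /= Nn Dw] Ww]] := Lv N.+1 isT W _; first exact: open_nbhs_nbhs.
  by apply: (gap_disjoint e3 UW _ Ww); apply: DU Dw; exact: ltnW.
have [|DN|DN] := (HN N (leqnn N)).2 _ _ (ofat B) (ofat B') fatgap.
- by rewrite subUset; split; apply: (HN _ _).1 => //=.
- apply: (@trapped (fat B) (fat B')) => //.
  + by move=> n /HN[].
  + by move=> w Dw; apply: DN; left.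
  + by have [v [Lv Gv]] := B'0; exists v; split => //; apply: sfat.
- apply: (@trapped (fat B') (fat B)) => //.
  + exact: gap_sym.
  + by move=> n /HN[+ _]; rewrite setUC.
  + by move=> w Dw; apply: DN; left.
  + by have [v Bv] := B0; exists v; split; [move: Bv; rewrite BG => -[]|apply: sfat].
Unshelve. all: by end_near. Qed.
End Limsup.

(** * Rotation vectors *)

Section RotationVectors.
Variables (R : realType) (tf : Sigma -> 'rV[R]_2 -> 'rV[R]_2).
Hypothesis tf_cont : continuous (Defs.skew tf).
Hypothesis tf_equiv : forall x, translation_equivariant (tf x).

Lemma fiber_iter_continuous n :
  continuous (fun xq : Sigma * 'rV[R]_2 => fiber_iter tf n xq.1 xq.2).
Proof.
have -> : (fun xq : Sigma * 'rV[R]_2 => fiber_iter tf n xq.1 xq.2) =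
    snd \o iter n (Defs.skew tf).
  by apply/funext => -[x q]; rewrite /= iter_skew.
have cit : continuous (iter n (Defs.skew tf)).
  elim: n => [|n IH] xq; first exact: cvg_id.
  by apply: continuous_comp (IH xq) _; exact: tf_cont.
by move=> xq; apply: continuous_comp; [exact: cit|exact: cvg_snd].
Qed.

Lemma fiber_iterSr n x q :
  fiber_iter tf n.+1 x q = fiber_iter tf n (left_shift x) (tf x q).
Proof.
have := iterSr n (Defs.skew tf) (x, q).
by rewrite [Defs.skew tf (x, q)]/Defs.skew/= !iter_skew => -[].
Qed.

(** By equivariance the displacement is determined by its values on a ball that
    meets every orbit of integer translations. *)
Lemma displacement_bounded :
  exists2 C : R, 0 < C & forall x q, `|tf x q - q| <= C.
Proof.
pose K : set (Sigma * 'rV[R]_2) := [set: Sigma] `*` closed_ball 0 1.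
have cK : compact K.
  apply: compact_setX; first exact: Sigma_compact.
  exact: closed_ball_compact.
pose phi (xq : Sigma * 'rV[R]_2) := tf xq.1 xq.2 - xq.2.
have cphi : continuous phi.
  move=> xq; have c2 : (@snd Sigma 'rV[R]_2) @ xq --> xq.2 by exact: cvg_snd.
  exact: (cvgB (@fiber_iter_continuous 1 xq) c2).
have := compact_bounded (continuous_compact (continuous_subspaceT cphi) cK).
move=> [M [_ /(_ (`|M| + 1)) bM]]; exists (`|M| + 1); first by rewrite ltr_wpDl.
move=> x q; have [v iv qv] := integral_approx q.
have -> : tf x q - q = phi (x, q - v).
  rewrite /phi/= tf_equiv; last exact: integralN.
  by rewrite opprB addrA subrK.
apply: bM; first by rewrite (le_lt_trans (ler_norm M))// ltrDl.
exists (x, q - v) => //; split => //=.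
by rewrite closed_ballE//= /closed_ball_/= sub0r normrN.
Qed.

Definition rotation_vector n x q := n%:R^-1 *: (fiber_iter tf n x q - q).

Lemma rho_setE n :
  rho_set tf n = \bigcup_x range (rotation_vector n x).
Proof.
apply/seteqP; split => v; first by move=> [x [p [q _ ->]]]; exists x => //; exists q.
by move=> [x _ [q _ <-]]; exists x, (torus_proj q), q.
Qed.

Lemma rotation_vector_continuous n :
  continuous (fun xq : Sigma * 'rV[R]_2 => rotation_vector n xq.1 xq.2).
Proof.
move=> xq; apply: cvgZl_tmp.
have c2 : (@snd Sigma 'rV[R]_2) @ xq --> xq.2 by exact: cvg_snd.
exact: (cvgB (@fiber_iter_continuous n xq) c2).
Qed.

Variable C : R.
Hypothesis C_gt0 : 0 < C.
Hypothesis displacement_le : forall x q, `|tf x q - q| <= C.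

Lemma fiber_iter_displacement n x q : `|fiber_iter tf n x q - q| <= n%:R * C.
Proof.
elim: n => [|n IH]; first by rewrite /= subrr normr0 mul0r.
rewrite /= -(subrKA (fiber_iter tf n x q)) (le_trans (ler_normD _ _))//.
by rewrite -natr1 mulrDl mul1r addrC lerD.
Qed.

Lemma rotation_vector_le n x q : `|rotation_vector n x q| <= C.
Proof.
rewrite normrZ normfV normr_nat; case: n => [|n].
  by rewrite invr0 mul0r ltW.
by rewrite ler_pdivrMl// fiber_iter_displacement.
Qed.

(** The two orbit segments overlap except for their first and last steps, each
    of length at most C. *)
Lemma rotation_vector_shift n x q : (0 < n)%N ->
  `|rotation_vector n x q - rotation_vector n (left_shift x) (tf x q)|
    <= 2 * C / n%:R.
Proof.
move=> n0; rewrite -scalerBr normrZ normfV normr_nat mulrC ler_pM2r ?invr_gt0 ?ltr0n//.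
rewrite -fiber_iterSr /=.
set r := fiber_iter tf n x q.
have -> : r - q - (tf (iter n left_shift x) r - tf x q) =
    (tf x q - q) - (tf (iter n left_shift x) r - r).
  by rewrite !opprB !addrA; congr (_ - _); rewrite addrC addrA addrAC.
rewrite (le_trans (ler_normB _ _))//.
have := displacement_le x q; have := displacement_le (iter n left_shift x) r; lra.
Qed.

(** The difference is 1/(n+1) times the difference between the mean displacement
    of the first n steps and the displacement of the next one. *)
Lemma rotation_vectorS n x q : (0 < n)%N ->
  `|rotation_vector n x q - rotation_vector n.+1 x q| <= 2 * C / n%:R.
Proof.
move=> n0; have n0' : (0 : R) < n%:R by rewrite ltr0n.
have n1' : (0 : R) < n.+1%:R by rewrite ltr0n.
set r := fiber_iter tf n x q.
have -> : rotation_vector n x q - rotation_vector n.+1 x q =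
   n.+1%:R^-1 *: (rotation_vector n x q - (tf (iter n left_shift x) r - r)).
  rewrite /rotation_vector /= -/r; apply/rowP => j; rewrite !mxE.
  by field; rewrite gt_eqF//= pnatr_eq0 -lt0n.
rewrite normrZ normfV normr_nat mulrC.
apply: ler_pM => //; last by rewrite lef_pV2 ?posrE// ler_nat.
rewrite (le_trans (ler_normB _ _))//.
have := displacement_le (iter n left_shift x) r.
have := rotation_vector_le n x q; lra.
Qed.

(** Once 2C/n < e, transitivity of the shift puts all fibres of D n on the same
    side of a splitting with gap e, and D n.+1 stays within e of D n. *)
Lemma rho_set_coarsely_connected (e : R) : 0 < e ->
  \forall n \near \oo, coarsely_connected e (rho_set tf n `|` rho_set tf n.+1).
Proof.
move=> e0; have Ce : 0 < 2 * C / e by rewrite divr_gt0 ?mulr_gt0.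
have /= := archi_boundP (ltW Ce).
set N := Num.bound _ => CN; exists N.+1 => // n /= Nn.
have n0 : (0 < n)%N by exact: leq_trans Nn.
have Cn : 2 * C / n%:R < e.
  rewrite ltr_pdivrMr ?ltr0n// -ltr_pdivrMl// mulrC.
  by apply: lt_le_trans CN _; rewrite ler_nat ltnW.
have fiber_dich x U W : open U -> open W -> gap e U W ->
    rho_set tf n `<=` U `|` W -> 
    range (rotation_vector n x) `<=` U \/ range (rotation_vector n x) `<=` W.
  move=> oU oW UW nUW; apply: (@connected_coarsely _ _ e _ e0 _ U W oU oW UW).
    apply: connected_continuous_connected; first exact: normedMod_connected.
    apply: continuous_subspaceT => q.
    have cx : {for q, continuous (fun q : 'rV[R]_2 => (x, q))}.
      apply: (@cvg_pair _ _ _ (nbhs q) (nbhs x) (nbhs q)).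
        exact: cvg_cst.
      exact: cvg_id.
    exact: (continuous_comp cx (@rotation_vector_continuous n _)).
  by apply: subset_trans nUW; rewrite rho_setE => v xv; exists x.
have cont0 : continuous (fun x => rotation_vector n x 0).
  move=> x; have c0 : {for x, continuous (fun x : Sigma => (x, 0 : 'rV[R]_2))}.
    apply: (@cvg_pair _ _ _ (nbhs x) (nbhs x) (nbhs (0 : 'rV[R]_2))).
      exact: cvg_id.
    exact: cvg_cst.
  exact: (continuous_comp c0 (@rotation_vector_continuous n _)).
apply: (@coarsely_connected_fatten _ _ _ (rho_set tf n)) => //; last first.
- move=> v [nv|]; first by exists v; rewrite ?subrr ?normr0.
  rewrite rho_setE => -[x _ [q _ <-]]; exists (rotation_vector n x q).
    by rewrite rho_setE; exists x => //; exists q.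
  by apply: le_lt_trans Cn; exact: rotation_vectorS.
move=> U W oU oW UW nUW.
(* The fibres over x and its shift have points closer than the gap. *)
  have inv k x : U (rotation_vector n x 0) ->
    U (rotation_vector n (iter k left_shift x) 0).
  move=> Ux; elim: k => [//|k IH]; rewrite iterS; set y := iter k _ _ in IH *.
  have yUW z q : U (rotation_vector n z q) -> range (rotation_vector n z) `<=` U.
    move=> Uzq; have [//|zW] := fiber_dich z U W oU oW UW nUW.
    by exfalso; apply: (gap_disjoint e0 UW Uzq); apply: zW; exists q.
  apply: (yUW _ (tf y 0)); last by exists 0.
  have [|//|Wy] := nUW (rotation_vector n (left_shift y) (tf y 0)) _.
    by rewrite rho_setE; exists (left_shift y) => //; exists (tf y 0).
  have := UW _ _ IH Wy; rewrite leNgt (le_lt_trans _ Cn)//.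
  exact: rotation_vector_shift.
apply: contrapT => /not_orP[nU nW].
have [x Ux] : exists x, U (rotation_vector n x 0).
  apply: contrapT => /forallNP Ux; apply: nW; rewrite rho_setE => v [x _ xv].
  have [xU|] := fiber_dich x U W oU oW UW nUW; last exact.
  by exfalso; apply: (Ux x); apply: xU; exists 0.
have [y Wy] : exists y, W (rotation_vector n y 0).
  apply: contrapT => /forallNP Wy; apply: nU; rewrite rho_setE => v [y _ yv].
  have [|yW] := fiber_dich y U W oU oW UW nUW; first exact.
  by exfalso; apply: (Wy y); apply: yW; exists 0.
have [||||k [z [Uz Wz]]] := @left_shift_transitive
    ((fun x => rotation_vector n x 0) @^-1` U) ((fun x => rotation_vector n x 0) @^-1` W).
- by move/continuousP : cont0; apply.
- by move/continuousP : cont0; apply.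
- by exists x.
- by exists y.
exact: (gap_disjoint e0 UW (inv k z Uz) Wz).
Qed.
End RotationVectors.

Theorem theorem1p1 (R : realType)
    (f : Sigma -> torus R -> torus R)
    (tf : Sigma -> 'rV[R]_2 -> 'rV[R]_2) :
  random_composition f -> continuous_lift f tf ->
  [/\ rho_mz tf !=set0, compact (rho_mz tf) & connected (rho_mz tf)].
Proof.
move=> [_ fP] [ctf ltf].
have eqtf x : translation_equivariant (tf x).
  by apply: (lift_equivariant (fP x).2) => //; exact: ((lift_continuousP tf).1 ctf).1.
have [C C0 tfC] := displacement_bounded ctf eqtf.
have -> : rho_mz tf = limsup_set (rho_set tf) by [].
have Dsub n : (0 < n)%N -> rho_set tf n `<=` closed_ball 0 C.
  rewrite rho_setE => _ _ [x _ [q _ <-]].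
  rewrite closed_ballE//= /closed_ball_/= sub0r normrN.
  exact: rotation_vector_le.
have cball := closed_ball_compact C0.
split.
- have [|v [Lv _]] := limsup_set_meets cball Dsub (@closedT _); last by exists v.
  move=> n; exists n => //; exists (rotation_vector tf n point 0); split => //.
  by rewrite rho_setE; exists point => //; exists 0.
- apply: (subclosed_compact _ cball); first exact: limsup_set_closed.
  by apply: limsup_set_sub Dsub; exact: closed_ball_closed.
- apply: (limsup_set_connected cball Dsub).
    move=> n; exists (rotation_vector tf n point 0).
    by rewrite rho_setE; exists point => //; exists 0.
  exact: (rho_set_coarsely_connected ctf C0 tfC).
Qed.
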